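(* Let $R$ be a ring and let $M$ be a quasi-duo right $R$-module. If $M$ is a subdirect product of simple modules, then all idempotents in $\operatorname{End}_R(M)$ are central. In particular, if moreover $M$ is endoregular, then $M$ is abelian endoregular.
   Context: Rings are associative with identity and modules are unitary right modules. A submodule $N$ of $M$ is fully invariant if $\varphi(N)\subseteq N$ for all $\varphi\in\operatorname{End}_R(M)$. A module is quasi-duo if every maximal submodule of it is fully invariant. A module $M$ is a subdirect product of a family $\{N_i\}_{i\in\mathcal I}$ if $M$ is (isomorphic to) a submodule of $\prod_{i\in\mathcal I} N_i$ such that every canonical projection restricted to $M$ is surjective. A ring $S$ is von Neumann regular if for every $s\in S$ there is $x\in S$ with $sxs=s$; it is abelian if every idempotent of $S$ is central. A module $M$ is endoregular if $\operatorname{End}_R(M)$ is von Neumann regular, and abelian endoregular if $\operatorname{End}_R(M)$ is abelian von Neumann regular. *)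

(* Defs.v *)
From HB Require Import structures.
From mathcomp Require Import all_boot all_algebra.
From mathcomp Require Import boolp.

Set Implicit Arguments.
Unset Strict Implicit.
Unset Printing Implicit Defensive.

Import GRing.Theory.
Local Open Scope ring_scope.

(* A right R-module is a left module over the converse ring R^c: the scaling
   a *: x stands for xa, and a *: (b *: x) = (b * a) *: x with b * a in R. *)
Notation rmodType R := (lmodType R^c).

Definition endo (R : pzRingType) (M : lmodType R) : Type := {linear M -> M}.

(* The ring End_R(M): addition is pointwise, multiplication is composition,
   with endomorphisms acting on the left, (f * g) x = f (g x). *)
Section EndoRing.
Variables (R : pzRingType) (M : lmodType R).
Implicit Types f g h : endo M.

HB.instance Definition _ := gen_eqMixin (endo M).
HB.instance Definition _ := gen_choiceMixin (endo M).

Lemma endoP f g : f =1 g -> f = g.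
Proof.
case: f => f cf; case: g => g cg /= /funext fg.
subst g; congr (GRing.Linear.Pack _).
case: cf => -[m1] [m2]; case: cg => -[n1] [n2].
by rewrite (Prop_irrelevance m1 n1) (Prop_irrelevance m2 n2).
Qed.

Definition endo0 : endo M := \0.
Definition endoN f : endo M := \- f.
Definition endoD f g : endo M := f \+ g.
Definition endo1 : endo M := idfun.
Definition endoM f g : endo M := f \o g.

Lemma endoDA : associative endoD.
Proof. by move=> f g h; apply: endoP => x; exact: addrA. Qed.
Lemma endoDC : commutative endoD.
Proof. by move=> f g; apply: endoP => x; exact: addrC. Qed.
Lemma endoD0 : left_id endo0 endoD.
Proof. by move=> f; apply: endoP => x; exact: add0r. Qed.
Lemma endoDN : left_inverse endo0 endoN endoD.
Proof. by move=> f; apply: endoP => x; exact: addNr. Qed.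

HB.instance Definition _ :=
  GRing.isZmodule.Build (endo M) endoDA endoDC endoD0 endoDN.

Lemma endoMA : associative endoM.
Proof. by move=> f g h; exact: endoP. Qed.
Lemma endo1M : left_id endo1 endoM.
Proof. by move=> f; exact: endoP. Qed.
Lemma endoM1 : right_id endo1 endoM.
Proof. by move=> f; exact: endoP. Qed.
Lemma endoMDl : left_distributive endoM (@GRing.add (endo M)).
Proof. by move=> f g h; exact: endoP. Qed.
Lemma endoMDr : right_distributive endoM (@GRing.add (endo M)).
Proof. by move=> f g h; apply: endoP => x; exact: raddfD. Qed.

HB.instance Definition _ := GRing.Zmodule_isPzRing.Build (endo M)
  endoMA endo1M endoM1 endoMDl endoMDr.

End EndoRing.

Definition prodmod (R : pzRingType) (I : Type) (N : I -> lmodType R) : Type :=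
  forall i, N i.

Section ProdModule.
Variables (R : pzRingType) (I : Type) (N : I -> lmodType R).
Implicit Types x y z : prodmod N.

HB.instance Definition _ := gen_eqMixin (prodmod N).
HB.instance Definition _ := gen_choiceMixin (prodmod N).

Lemma prodmodP x y : (forall i, x i = y i) -> x = y.
Proof. exact: functional_extensionality_dep. Qed.

Definition prodmod0 : prodmod N := fun=> 0.
Definition prodmodN x : prodmod N := fun i => - x i.
Definition prodmodD x y : prodmod N := fun i => x i + y i.
Definition prodmodZ (a : R) x : prodmod N := fun i => a *: x i.

Lemma prodmodDA : associative prodmodD.
Proof. by move=> x y z; apply: prodmodP => i; exact: addrA. Qed.
Lemma prodmodDC : commutative prodmodD.
Proof. by move=> x y; apply: prodmodP => i; exact: addrC. Qed.
Lemma prodmodD0 : left_id prodmod0 prodmodD.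
Proof. by move=> x; apply: prodmodP => i; exact: add0r. Qed.
Lemma prodmodDN : left_inverse prodmod0 prodmodN prodmodD.
Proof. by move=> x; apply: prodmodP => i; exact: addNr. Qed.

HB.instance Definition _ :=
  GRing.isZmodule.Build (prodmod N) prodmodDA prodmodDC prodmodD0 prodmodDN.

Lemma prodmodZA a b x : prodmodZ a (prodmodZ b x) = prodmodZ (a * b) x.
Proof. by apply: prodmodP => i; exact: scalerA. Qed.
Lemma prodmod1Z : left_id 1 prodmodZ.
Proof. by move=> x; apply: prodmodP => i; exact: scale1r. Qed.
Lemma prodmodZDr : right_distributive prodmodZ +%R.
Proof. by move=> a x y; apply: prodmodP => i; exact: scalerDr. Qed.
Lemma prodmodZDl x : {morph prodmodZ^~ x : a b / a + b}.
Proof. by move=> a b; apply: prodmodP => i; exact: scalerDl. Qed.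

HB.instance Definition _ := GRing.Zmodule_isLmodule.Build R (prodmod N)
  prodmodZA prodmod1Z prodmodZDr prodmodZDl.

Definition prodmod_proj (i : I) (x : prodmod N) : N i := x i.

End ProdModule.

Section Modules.
Variables (R : pzRingType) (M : lmodType R).

(* Submodules are boolean predicates satisfying [submod_closed]; in the
   presence of the classical axioms of [boolp] these are all submodules. *)
Definition fully_invariant (N : {pred M}) : Prop :=
  forall (f : endo M) (x : M), x \in N -> f x \in N.

Definition proper_submod (N : {pred M}) : Prop :=
  submod_closed N /\ exists x, x \notin N.

Definition maximal_submod (N : {pred M}) : Prop :=
  proper_submod N /\
  forall L : {pred M}, proper_submod L -> {subset N <= L} -> L =i N.

Definition quasi_duo : Prop :=
  forall N : {pred M}, maximal_submod N -> fully_invariant N.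

Definition simple_module : Prop :=
  (exists x : M, x != 0) /\
  forall N : {pred M}, submod_closed N -> N =i pred1 0 \/ N =i predT.

(* The image of f is a submodule of the product isomorphic to M. *)
Definition subdirect_product (I : Type) (N : I -> lmodType R) : Prop :=
  exists f : {linear M -> prodmod N},
    injective f /\
    forall (i : I) (y : N i), exists x : M, prodmod_proj i (f x) = y.

End Modules.

Section Rings.
Variable S : pzRingType.

Definition von_neumann_regular : Prop :=
  forall s : S, exists x : S, s * x * s = s.

Definition central (e : S) : Prop := forall s : S, GRing.comm e s.

Definition abelian_ring : Prop := forall e : S, e * e = e -> central e.

End Rings.

Definition endoregular (R : pzRingType) (M : lmodType R) : Prop :=
  von_neumann_regular (endo M).

Definition abelian_endoregular (R : pzRingType) (M : lmodType R) : Prop :=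
  abelian_ring (endo M) /\ von_neumann_regular (endo M).

Arguments quasi_duo {R} M.
Arguments simple_module {R} M.
Arguments subdirect_product {R} M {I} N.

(* Main.v *)
(** If [N] is simple, the kernel [K] of a surjection [M -> N] is a maximal
    submodule, so it is fully invariant when [M] is quasi-duo.  For [e]
    idempotent, the preimage of [K] under [e] is then a submodule containing
    [K], hence equal to [M] or to [K]: either [e M] or [(1 - e) M] lies in [K].
    In both cases [e s (1 - e)] and [(1 - e) s e] map [M] into [K].  The kernels
    of the projections of a subdirect product intersect in [0], so both of these
    endomorphisms vanish and [e] commutes with [s]. *)
From HB Require Import structures.
Require Import Defs.
From mathcomp Require Import all_boot all_algebra.
From mathcomp Require Import boolp.

Set Implicit Arguments.
Unset Strict Implicit.
Unset Printing Implicit Defensive.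

Import GRing.Theory.
Local Open Scope ring_scope.

HB.instance Definition _ (R : pzRingType) (I : Type) (N : I -> lmodType R)
    (i : I) :=
  GRing.isLinear.Build R (prodmod N) (N i) *:%R (prodmod_proj i)
    (fun _ _ _ => erefl).

(** Expanding the two off-diagonal Peirce corners shows that [e * s] and [s * e] both equal
    [e * s * e]. *)
Lemma comm_idem (S : pzRingType) (e s : S) :
  e * s * (1 - e) = 0 -> (1 - e) * s * e = 0 -> GRing.comm e s.
Proof.
rewrite mulrBr mulr1 mulrBl mul1r mulrBl => /subr0_eq es /subr0_eq se.
by rewrite /GRing.comm es se.
Qed.

Lemma submod_closed_preim (R : pzRingType) (M : lmodType R)
    (f : endo M) (K : {pred M}) :
  submod_closed K -> submod_closed [pred x | f x \in K].
Proof.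
move=> [K0 KL]; split=> [|a x y]; first by rewrite inE raddf0.
by rewrite !inE linearP; apply: KL.
Qed.

Section Kernel.
Variables (R : pzRingType) (M N : lmodType R) (g : {linear M -> N}).

Definition kerpred : {pred M} := [pred x | g x == 0].

Lemma kerpredE x : (x \in kerpred) = (g x == 0).
Proof. by []. Qed.

Lemma submod_closed_ker : submod_closed kerpred.
Proof.
split=> [|a x y]; rewrite !kerpredE ?raddf0// => /eqP gx /eqP gy.
by rewrite linearP gx gy scaler0 addr0.
Qed.

Lemma submod_closed_img (L : {pred M}) : submod_closed L ->
  submod_closed [pred y | `[< exists2 x, x \in L & g x = y >]].
Proof.
move=> [L0 LL]; split=> [|a y z]; rewrite !inE.
  by apply/asboolP; exists 0 => //; rewrite raddf0.
move=> /asboolP[x Lx <-] /asboolP[x' Lx' <-].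
by apply/asboolP; exists (a *: x + x'); rewrite ?linearP//; apply: LL.
Qed.

Lemma maximal_ker :
  simple_module N -> (forall y, exists x, g x = y) -> maximal_submod kerpred.
Proof.
move=> [[y0 y0N0] simpleN] g_surj; split.
  split; first exact: submod_closed_ker.
  by have [x gx] := g_surj y0; exists x; rewrite kerpredE gx.
move=> L [L_closed [z zL]] KL x.
apply/idP/idP => [Lx|]; last exact: KL.
(* The image of [L] is [0], which puts [x] in the kernel, or all of [N]; then [g z = g l] with [l]
   in [L], and [z = (z - l) + l] would lie in [L]. *)
have [/(_ (g x))|/(_ (g z))] := simpleN _ (submod_closed_img L_closed).
  by rewrite !inE => <-; apply/asboolP; exists x.
rewrite !inE => /asboolP[l Ll gl].
have /KL Lzl : z - l \in kerpred by rewrite kerpredE raddfB/= gl subrr.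
case/negP: zL.
by rewrite -[z](subrK l) -[z - l]scale1r; apply: L_closed.2.
Qed.

End Kernel.

Lemma maximal_fully_invariant_idem (R : pzRingType) (M : lmodType R)
    (K : {pred M}) (e : endo M) :
  maximal_submod K -> fully_invariant K -> e * e = e ->
  (forall x, e x \in K) \/ (forall x, (1 - e) x \in K).
Proof.
move=> [[K_closed _] K_max] K_inv ee.
have [|/existsNP[z /negP zK]] := pselect (forall x, e x \in K); first by left.
have L_proper : proper_submod [pred x | e x \in K].
  by split; [exact: submod_closed_preim | exists z].
(* By maximality it is enough that [e] sends [(1 - e) x] into [K], and [e * (1 - e) = 0]. *)
right=> x; rewrite -(K_max _ L_proper); last by move=> y Ky; exact: K_inv.
rewrite inE -[e _]/((e * (1 - e)) x) mulrBr mulr1 ee subrr.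
exact: K_closed.1.
Qed.

Lemma maximal_fully_invariant_peirce (R : pzRingType) (M : lmodType R)
    (K : {pred M}) (e s : endo M) (x : M) :
  maximal_submod K -> fully_invariant K -> e * e = e ->
  (e * s * (1 - e)) x \in K /\ ((1 - e) * s * e) x \in K.
Proof.
move=> K_max K_inv ee; rewrite -!mulrA.
have [eK|eK] := maximal_fully_invariant_idem K_max K_inv ee; split.
(* If the outermost factor maps [M] into [K], nothing is left to prove; otherwise the innermost one
   does, and full invariance carries [K] through the other two. *)
- exact: eK.
- exact: (K_inv (1 - e) _ (K_inv s _ (eK x))).
- exact: (K_inv e _ (K_inv s _ (eK x))).
- exact: eK.
Qed.

Theorem proposition3p1 (R : pzRingType) (M : rmodType R)
    (quasi_duo_M : quasi_duo M)
    (I : Type) (N : I -> rmodType R)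
    (simple_N : forall i : I, simple_module (N i))
    (subdirect_M : subdirect_product M N) :
  (forall e : endo M, e * e = e -> central e) /\
  (endoregular M -> abelian_endoregular M).
Proof.
suff idem_central (e : endo M) : e * e = e -> central e by split.
have [f [f_inj f_surj]] := subdirect_M.
pose g i : {linear M -> N i} := prodmod_proj i \o f.
have K_max i : maximal_submod (kerpred (g i)).
  by apply: maximal_ker => // y; exact: f_surj.
have K_cap x : (forall i, x \in kerpred (g i)) -> x = 0.
  (* All coordinates of [f x] vanish, so injectivity of [f] gives [x = 0]. *)
  move=> xK; apply: f_inj; rewrite raddf0; apply: prodmodP => i.
  by move/eqP: (xK i).
move=> ee s.
have K_peirce x i :=
  maximal_fully_invariant_peirce s x (K_max i) (quasi_duo_M _ (K_max i)) ee.
by apply: comm_idem; apply: endoP => x; apply: K_cap => i; have [] := K_peirce x i.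
Qed.
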